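(* Let $E$ be a countable state-space, let $s_0\in E$, and consider two discrete-time stochastic processes taking values in $E$, both started at the same initial state $s_0$, with genealogical probabilities $p(\mathbf{s})$ and $q(\mathbf{s})$ respectively. Then a MEXIT coupling of the two processes can be constructed: there exists a non-negative function $r(\mathbf{s},\mathbf{t})$, defined for all pairs of genealogies $\mathbf{s},\mathbf{t}$ of equal length started at $s_0$, such that for all such $\mathbf{s},\mathbf{t}$ (sums being over genealogies of the same length as the fixed one, and $a,b$ ranging over $E$) \begin{align*} \sum_{\mathbf{t}} r(\mathbf{s},\mathbf{t}) &= p(\mathbf{s}),\\ \sum_{\mathbf{s}} r(\mathbf{s},\mathbf{t}) &= q(\mathbf{t}),\\ \sum_a\sum_b r(\mathbf{s}\cdot a,\mathbf{t}\cdot b) &= r(\mathbf{s},\mathbf{t}),\\ r(\mathbf{s},\mathbf{s}) &= p(\mathbf{s})\wedge q(\mathbf{s}). \end{align*}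
   Context: A genealogy at time $n$ is a finite sequence $\mathbf{s}=(s_0,s_1,\ldots,s_n)$ of $n+1$ states in $E$ starting at the fixed state $s_0$; $\mathbf{s}\cdot a$ denotes the genealogy $(s_0,s_1,\ldots,s_n,a)$. The genealogical probability $p(\mathbf{s})$ (respectively $q(\mathbf{s})$) is the probability that the first (respectively second) process follows the path $\mathbf{s}$ during times $0,\ldots,n$; thus $p((s_0))=q((s_0))=1$ and $\sum_a p(\mathbf{s}\cdot a)=p(\mathbf{s})$, $\sum_a q(\mathbf{s}\cdot a)=q(\mathbf{s})$. The processes are not assumed to be Markov. A coupling is given by probabilities $r(\mathbf{s},\mathbf{t})$ of seeing the pair of genealogies $(\mathbf{s},\mathbf{t})$ at time $n$ which satisfy the first three displayed identities (row marginals, column marginals, inheritance); it is called a MEXIT coupling if in addition the fourth identity holds for all genealogies $\mathbf{s}$. Here $x\wedge y=\min\{x,y\}$. *)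

(* Defs.v *)
From mathcomp Require Import all_boot all_order all_algebra.
From mathcomp Require Import all_classical all_reals all_analysis.

Set Implicit Arguments.
Unset Strict Implicit.
Unset Printing Implicit Defensive.

Import Order.TTheory GRing.Theory Num.Theory.

Local Open Scope classical_set_scope.
Local Open Scope ring_scope.
Local Open Scope ereal_scope.

(* A genealogy (s_0, ..., s_n) is the sequence [:: s_0; ...; s_n] of size n.+1;
   appending a state, s . a, is [rcons s a]. *)
Definition genealogy (E : choiceType) (s0 : E) (n : nat) : set (seq E) :=
  [set s | size s = n.+1 /\ ohead s = Some s0].

(* [mkseq (fun i => X i w) n.+1] is the path (X_0 w, ..., X_n w); the process X
   is arbitrary, in particular not assumed to be Markov. *)
Definition genealogical_probability d dE (T : measurableType d)
    (E : measurableType dE) (R : realType) (P : probability T R)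
    (X : nat -> {RV P >-> E}) (s : seq E) : \bar R :=
  P [set w | mkseq (fun i => X i w) (size s) = s].

(* The values of r on pairs of sequences that are not genealogies of equal
   length started at s0 are irrelevant. *)
Definition is_coupling (E : choiceType) (R : realType) (s0 : E)
    (p q : seq E -> \bar R) (r : seq E -> seq E -> R) : Prop :=
  forall n s t, genealogy s0 n s -> genealogy s0 n t ->
  [/\ (0 <= r s t)%R,
      \esum_(t' in genealogy s0 n) (r s t')%:E = p s,
      \esum_(s' in genealogy s0 n) (r s' t)%:E = q t
    & \esum_(a in [set: E]) \esum_(b in [set: E])
        (r (rcons s a) (rcons t b))%:E = (r s t)%:E].

Definition is_MEXIT_coupling (E : choiceType) (R : realType) (s0 : E)
    (p q : seq E -> \bar R) (r : seq E -> seq E -> R) : Prop :=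
  is_coupling s0 p q r /\
  forall n s, genealogy s0 n s -> (r s s)%:E = mine (p s) (q s).

(* Main.v *)
Require Import Defs.
From mathcomp Require Import all_boot all_order all_algebra.
From mathcomp Require Import all_classical all_reals all_analysis.

(** The coupling is built one generation at a time.  Write m = p /\ q for the
    overlap of the two path laws, and K(s) = sum_a m(s.a) for the part of the
    overlap at s that survives for one more step.  Suppose that r couples p and
    q at time n, with r(s, s) = m(s).  As K(s) <= m(s), the mass K(s) can be
    set aside from each diagonal cell of r and sent to the new diagonal cells,
    m(s.a) going to (s.a, s.a): this is exactly what the fourth identity asks
    for at time n+1.

    What remains is the residual rho(s, t) = r(s, t) - [s = t] K(s), a
    non-negative function with marginals p - K and q - K.  It has to be
    distributed over the children, whose excess probabilities p(s.a) - m(s.a)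
    and q(t.b) - m(t.b) have totals p(s) - K(s) and q(t) - K(t) over a and b.
    So the children are drawn independently given (s, t), proportionally to
    these excesses:

      r(s.a, t.b) = [s.a = t.b] m(s.a)
        + (p(s.a) - m(s.a)) / (p(s) - K(s))
          * (q(t.b) - m(t.b)) / (q(t) - K(t)) * rho(s, t).

    The second term vanishes on the diagonal, because one of the two excesses
    at s.a is zero, so the diagonal still carries the overlap.  Inheritance and
    the marginals follow by summing first over b, which removes the last
    quotient ([esum_extend]).  A denominator may be zero, but then the marginal
    of rho is zero, and so is rho itself.

    This argument uses only that p and q are non-negative, that they equal 1 at
    (s_0), and that the children of s share its probability ([path_law]).  For
    genealogical probabilities the last point is countable additivity. *)

Set Implicit Arguments.
Unset Strict Implicit.
Unset Printing Implicit Defensive.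

Import Order.TTheory GRing.Theory Num.Theory.

Local Open Scope classical_set_scope.
Local Open Scope ring_scope.
Local Open Scope ereal_scope.

(** * Sums of non-negative families *)

Section esum_complements.
Context (R : realType) (T : choiceType).
Implicit Types (D : set T) (f : T -> \bar R).

Lemma ge0_esumZl D f (c : R) : (0 <= c)%R -> (forall i, D i -> 0 <= f i) ->
  \esum_(i in D) (c%:E * f i) = c%:E * \esum_(i in D) f i.
Proof.
move=> c0 f0; rewrite /esum -ereal_supZl//; last first.
  apply/set0P; exists (\sum_(i \in set0) f i).
  by exists set0 => //; exact: fsets_set0.
rewrite image_comp; congr ereal_sup.
apply: eq_imagel => X [finX XD] /=.
rewrite !fsbig_finite//= [in RHS]big_seq_cond ge0_sume_distrr.
  by rewrite -big_seq_cond.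
by move=> i; rewrite andbT in_fset_set// inE => /XD/f0.
Qed.

Lemma esum_single D f x : D x -> 0 <= f x ->
  (forall y, D y -> y != x -> f y = 0) -> \esum_(y in D) f y = f x.
Proof.
move=> Dx fx0 f0; rewrite (esumID [set x]); last first.
  by move=> y Dy; have [->//|/f0->] := eqVneq y x.
rewrite (_ : D `&` [set x] = [set x]); last by apply/setIidPr => _ ->.
rewrite esum_set1// [X in _ + X]esum1 ?adde0// => y [Dy /= /eqP].
exact: f0.
Qed.

Lemma esum_indic D x (c : R) : D x -> (0 <= c)%R ->
  \esum_(y in D) ((x == y)%:R * c)%:E = c%:E.
Proof.
move=> Dx c0; rewrite (@esum_single _ _ x) ?eqxx ?mul1r//.
by move=> y _ yx; rewrite eq_sym (negbTE yx) mul0r.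
Qed.

Lemma esum_ge_term D f x : D x -> f x <= \esum_(y in D) f y.
Proof.
move=> Dx; apply: esum_ge; exists [set x]; last by rewrite fsbig_set1.
by split=> // _ ->.
Qed.

End esum_complements.

(** The index set may have any countable type, so that the conclusion is a sum
    over a set and not a series; the proof transports it to the naturals. *)
Lemma measure_countable_bigcup (R : realType) (d : measure_display)
    (T : measurableType d) (mu : {measure set T -> \bar R}) (I : choiceType)
    (D : set I) (F : I -> set T) : countable D ->
    (forall i, D i -> measurable (F i)) -> trivIset D F ->
  mu (\bigcup_(i in D) F i) = \esum_(i in D) mu (F i).
Proof.
move=> /countable_injP[f finj] mF tF.
pose G n := \bigcup_(i in [set i | D i /\ f i = n]) F i.
have GF i : D i -> G (f i) = F i.
  move=> Di; apply/seteqP; split=> [x [j [Dj fji] Fjx]|x Fix]; last by exists i.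
  by rewrite -(finj j i) ?inE.
have -> : \bigcup_(i in D) F i = \bigcup_(n in f @` D) G n.
  rewrite bigcup_image; apply: eq_bigcupr => i Di; exact/esym/GF.
rewrite measure_bigcup; first last.
- apply/trivIsetP => _ _ [i Di <-] [j Dj <-] fij; rewrite !GF//.
  by move/trivIsetP: tF; apply=> //; apply: contraNneq fij => ->.
- by move=> _ [i Di <-]; rewrite GF//; exact: mF.
rewrite nneseries_esum// set_mem_set esum_image//.
by apply: eq_esum => i /GF ->.
Qed.

(** * Genealogies and their children *)

Section genealogies.
Context (E : choiceType) (s0 : E).

Definition parent (s : seq E) := take (size s).-1 s.

Lemma parent_rcons s a : parent (rcons s a) = s.
Proof. by rewrite /parent size_rcons -cats1 take_size_cat. Qed.

Lemma genealogy_rcons n s a :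
  genealogy s0 n s -> genealogy s0 n.+1 (rcons s a).
Proof.
by case: s => [|x s] [//= [sz] [->]]; rewrite /genealogy/= size_rcons sz.
Qed.

Lemma genealogySP n s : genealogy s0 n.+1 s ->
  exists t a, s = rcons t a /\ genealogy s0 n t.
Proof.
elim/last_ind: s => [[]//|s a _] [/eqP]; rewrite size_rcons eqSS => /eqP sz hd.
by exists s, a; split=> //; split=> //; case: s sz hd.
Qed.

Lemma esum_genealogyS (R : realType) n (f : seq E -> \bar R) :
    (forall s, genealogy s0 n.+1 s -> 0 <= f s) ->
  \esum_(s in genealogy s0 n.+1) f s =
  \esum_(s in genealogy s0 n) \esum_(a in [set: E]) f (rcons s a).
Proof.
move=> f0; rewrite esum_esum; last by move=> s a /genealogy_rcons/f0.
apply: (reindex_esum _ _ (fun k => rcons k.1 k.2)); split.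
- by move=> [s a] [/= /genealogy_rcons].
- by move=> [s a] [t b] _ _ /= /rcons_inj [-> ->].
- by move=> _ /genealogySP[s [a [-> Gs]]]; exists (s, a).
Qed.

End genealogies.

(** * Path laws and their overlap *)

Section path_laws.
Context (R : realType) (E : choiceType).
Implicit Types (p q : seq E -> R) (s : seq E).

Definition path_law p :=
  (forall s, 0 <= p s)%R /\
  (forall s, \esum_(a in [set: E]) (p (rcons s a))%:E = (p s)%:E).

Definition overlap p q s : R := Num.min (p s) (q s).

(** The sum is finite, being at most p s, so that [fine] loses nothing
    ([esum_overlap]). *)
Definition kept p q s : R :=
  fine (\esum_(a in [set: E]) (overlap p q (rcons s a))%:E).

Lemma overlapC p q s : overlap p q s = overlap q p s.
Proof. by rewrite /overlap minC. Qed.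

Lemma keptC p q s : kept p q s = kept q p s.
Proof. by congr fine; apply: eq_esum => a _; rewrite overlapC. Qed.

Lemma overlap_le p q s : (overlap p q s <= p s)%R.
Proof. by rewrite ge_min lexx. Qed.

Lemma esum_overlap_le p q s : path_law p ->
  \esum_(a in [set: E]) (overlap p q (rcons s a))%:E <= (p s)%:E.
Proof.
by move=> [_ <-]; apply: le_esum => a _; rewrite lee_fin overlap_le.
Qed.

Context (p q : seq E -> R) (lp : path_law p) (lq : path_law q).

Lemma overlap_ge0 s : (0 <= overlap p q s)%R.
Proof. by rewrite le_min lp.1 lq.1. Qed.

Lemma esum_overlap s :
  \esum_(a in [set: E]) (overlap p q (rcons s a))%:E = (kept p q s)%:E.
Proof.
rewrite fineK// ge0_fin_numE; last first.
  by apply: esum_ge0 => a _; rewrite lee_fin overlap_ge0.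
exact: le_lt_trans (esum_overlap_le q s lp) (ltry _).
Qed.

Lemma kept_ge0 s : (0 <= kept p q s)%R.
Proof. by apply/fine_ge0/esum_ge0 => a _; rewrite lee_fin overlap_ge0. Qed.

(** A sum of minima is at most the minimum of the sums; this is why the
    diagonal mass at time n is enough to feed the diagonal at time n+1. *)
Lemma kept_le_overlap s : (kept p q s <= overlap p q s)%R.
Proof.
rewrite le_min -!lee_fin -esum_overlap esum_overlap_le//=.
by under eq_esum => a _ do rewrite overlapC; exact: esum_overlap_le.
Qed.

Lemma kept_le s : (kept p q s <= p s)%R.
Proof. exact: le_trans (kept_le_overlap s) (overlap_le p q s). Qed.

Lemma esum_excess s :
  \esum_(a in [set: E]) (p (rcons s a) - overlap p q (rcons s a))%:E =
  (p s - kept p q s)%:E.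
Proof.
rewrite EFinB -lp.2 -esum_overlap.
under [in RHS]eq_esum => a _ do
  rewrite -[p _](subrK (overlap p q (rcons s a))) EFinD.
rewrite esumD ?esum_overlap ?addeK// => a _; rewrite lee_fin.
  by rewrite subr_ge0 overlap_le.
exact: overlap_ge0.
Qed.

Lemma excess_le s a :
  (p (rcons s a) - overlap p q (rcons s a) <= p s - kept p q s)%R.
Proof.
rewrite -lee_fin -esum_excess.
exact: (esum_ge_term
  (fun b => (p (rcons s b) - overlap p q (rcons s b))%:E)).
Qed.

End path_laws.

(** The weight with which the genealogy s receives residual mass from its
    parent.  When the parent has no excess, division by zero makes it 0. *)
Definition share (R : realType) (E : choiceType) (p q : seq E -> R)
    (s : seq E) : R :=
  ((p s - overlap p q s) / (p (parent s) - kept p q (parent s)))%R.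

Section shares.
Context (R : realType) (E : choiceType) (p q : seq E -> R).
Hypotheses (lp : path_law p) (lq : path_law q).

Lemma share_ge0 s : (0 <= share p q s)%R.
Proof. by rewrite divr_ge0// subr_ge0 ?overlap_le// kept_le. Qed.

Lemma esum_share s : (p s - kept p q s != 0)%R ->
  \esum_(a in [set: E]) (share p q (rcons s a))%:E = 1.
Proof.
move=> ne0; have inv0 : (0 <= (p s - kept p q s)^-1)%R.
  by rewrite invr_ge0 subr_ge0 kept_le.
rewrite /share; under eq_esum => a _ do rewrite parent_rcons mulrC EFinM.
rewrite ge0_esumZl// ?esum_excess// -?EFinM ?mulVf// => a _.
by rewrite lee_fin subr_ge0 overlap_le.
Qed.

(** Also true when the denominator of the share is zero: a child's excess is
    bounded by the total, hence zero too. *)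
Lemma shareK s a :
  (share p q (rcons s a) * (p s - kept p q s) =
   p (rcons s a) - overlap p q (rcons s a))%R.
Proof.
rewrite /share parent_rcons.
have [e|ne0] := eqVneq (p s - kept p q s)%R 0%R; last by rewrite divfK.
rewrite e mulr0; apply/esym/eqP; rewrite eq_le subr_ge0 overlap_le andbT -e.
exact: excess_le.
Qed.

End shares.

(** * One step of the coupling *)

Section extension.
Context (R : realType) (E : choiceType).
Implicit Types (p q : seq E -> R) (r : seq E -> seq E -> R) (s t : seq E).

Definition residual p q r s t : R := (r s t - (s == t)%:R * kept p q s)%R.

Definition extend p q r s t : R :=
  ((s == t)%:R * overlap p q s +
   share p q s * share q p t * residual p q r (parent s) (parent t))%R.

(** The induction hypothesis: r is a coupling at time n whose diagonal is the
    overlap.  Non-negativity and the diagonal concern only some of the pairs,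
    but one quantification over s and t keeps the property symmetric. *)
Definition couples (s0 : E) (n : nat) p q r :=
  forall s t, genealogy s0 n s -> genealogy s0 n t ->
  [/\ (0 <= r s t)%R,
      \esum_(t' in genealogy s0 n) (r s t')%:E = (p s)%:E,
      \esum_(s' in genealogy s0 n) (r s' t)%:E = (q t)%:E
    & r s s = overlap p q s].

(** The next three lemmas say that the construction commutes with exchanging
    the two processes, so that facts about columns follow from facts about
    rows. *)
Lemma couplesC (s0 : E) n p q r :
  couples s0 n p q r -> couples s0 n q p (fun s t => r t s).
Proof.
move=> cr s t Gs Gt; have [? ? ? _] := cr t s Gt Gs.
by have [_ _ _ ?] := cr s t Gs Gt; rewrite overlapC.
Qed.

Lemma residualC p q r s t :
  residual q p (fun s t => r t s) t s = residual p q r s t.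
Proof.
by rewrite /residual eq_sym keptC; case: eqVneq => [->|_]; rewrite ?mul0r.
Qed.

Lemma extendC p q r s t :
  extend q p (fun s t => r t s) t s = extend p q r s t.
Proof.
rewrite /extend residualC eq_sym overlapC (mulrC (share _ _ t)).
by congr (_ + _)%R; case: eqVneq => [->|_]; rewrite ?mul0r.
Qed.

Section residuals.
Context (s0 : E) (n : nat) (p q : seq E -> R) (r : seq E -> seq E -> R).
Hypotheses (lp : path_law p) (lq : path_law q) (cr : couples s0 n p q r).

Lemma residual_ge0 s t : genealogy s0 n s -> genealogy s0 n t ->
  (0 <= residual p q r s t)%R.
Proof.
move=> Gs Gt; rewrite /residual; have [r0 _ _ rss] := cr Gs Gt.
case: eqVneq => [<-|_]; last by rewrite mul0r subr0.
by rewrite mul1r subr_ge0 rss kept_le_overlap.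
Qed.

Lemma esum_residual s : genealogy s0 n s ->
  \esum_(t in genealogy s0 n) (residual p q r s t)%:E = (p s - kept p q s)%:E.
Proof.
move=> Gs; have [_ rp _ _] := cr Gs Gs; rewrite EFinB -rp.
under [in RHS]eq_esum => t _ do
  rewrite -[r s t](subrK ((s == t)%:R * kept p q s)%R)
    -/(residual p q r s t) EFinD.
rewrite esumD.
- by rewrite esum_indic ?kept_ge0// addeK.
- by move=> t Gt; rewrite lee_fin residual_ge0.
- by move=> t _; rewrite lee_fin mulr_ge0// kept_ge0.
Qed.

(** Deals with the vanishing denominators: where the excess of s is used up,
    there is no residual mass left to distribute. *)
Lemma residual_eq0 s t : genealogy s0 n s -> genealogy s0 n t ->
  (p s - kept p q s = 0)%R -> residual p q r s t = 0%R.
Proof.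
move=> Gs Gt e; apply/eqP; rewrite eq_le residual_ge0// andbT -e.
rewrite -lee_fin -(esum_residual Gs).
exact: (esum_ge_term (fun t => (residual p q r s t)%:E)).
Qed.

End residuals.

Section extend_couples.
Context (s0 : E) (n : nat) (p q : seq E -> R) (r : seq E -> seq E -> R).
Hypotheses (lp : path_law p) (lq : path_law q) (cr : couples s0 n p q r).

(** The central computation: summing over the second child alone leaves the
    kept mass of the cell (s, t) and the share of its residual that goes to
    s.a.  Both the marginals and inheritance are sums of this identity, over t
    and over a. *)
Lemma esum_extend s t a : genealogy s0 n s -> genealogy s0 n t ->
  \esum_(b in [set: E]) (extend p q r (rcons s a) (rcons t b))%:E =
  ((s == t)%:R * overlap p q (rcons s a) +
   share p q (rcons s a) * residual p q r s t)%:E.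
Proof.
move=> Gs Gt.
have c0 : (0 <= share p q (rcons s a) * residual p q r s t)%R.
  by rewrite mulr_ge0 ?share_ge0// (residual_ge0 lp lq cr).
transitivity (\esum_(b in [set: E])
    (((a == b)%:R * ((s == t)%:R * overlap p q (rcons s a)))%:E +
     (share p q (rcons s a) * residual p q r s t)%:E *
     (share q p (rcons t b))%:E)).
  apply: eq_esum => b _; rewrite /extend !parent_rcons eqseq_rcons.
  rewrite -EFinM -EFinD -mulnb natrM; congr ((_ + _)%:E).
    by rewrite mulrA (mulrC (a == b)%:R%R).
  by rewrite mulrAC.
rewrite esumD; first last.
- by move=> b _; rewrite -EFinM lee_fin mulr_ge0// share_ge0.
- by move=> b _; rewrite lee_fin !mulr_ge0// overlap_ge0.
rewrite esum_indic//; last by rewrite mulr_ge0// overlap_ge0.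
rewrite ge0_esumZl//; last by move=> b _; rewrite lee_fin share_ge0.
rewrite EFinD; congr (_ + _).
have [e|ne0] := eqVneq (q t - kept q p t)%R 0%R.
  rewrite -residualC (residual_eq0 lq lp (couplesC cr) Gt Gs e).
  by rewrite mulr0 mul0e.
by rewrite esum_share// mule1.
Qed.

Lemma extend_ge0 s t : genealogy s0 n.+1 s -> genealogy s0 n.+1 t ->
  (0 <= extend p q r s t)%R.
Proof.
move=> /genealogySP[{}s [a [-> Gs]]] /genealogySP[{}t [b [-> Gt]]].
rewrite /extend !parent_rcons addr_ge0//.
  by rewrite mulr_ge0// overlap_ge0.
rewrite mulr_ge0 ?(residual_ge0 lp lq cr)//.
by rewrite mulr_ge0// share_ge0.
Qed.

Lemma extend_inherits s t : genealogy s0 n s -> genealogy s0 n t ->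
  \esum_(a in [set: E]) \esum_(b in [set: E])
    (extend p q r (rcons s a) (rcons t b))%:E = (r s t)%:E.
Proof.
move=> Gs Gt; have rho0 := residual_ge0 lp lq cr Gs Gt.
under eq_esum => a _ do
  rewrite (esum_extend a Gs Gt) EFinD EFinM (mulrC (share _ _ _)) EFinM.
rewrite esumD; first last.
- by move=> a _; rewrite -EFinM lee_fin mulr_ge0// share_ge0.
- by move=> a _; rewrite -EFinM lee_fin mulr_ge0// overlap_ge0.
rewrite !ge0_esumZl//; first last.
- by move=> a _; rewrite lee_fin overlap_ge0.
- by move=> a _; rewrite lee_fin share_ge0.
have -> : (r s t)%:E =
    (s == t)%:R%:E * (kept p q s)%:E + (residual p q r s t)%:E.
  by rewrite -EFinM -EFinD /residual addrC subrK.
rewrite esum_overlap//; congr (_ + _).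
have [e|ne0] := eqVneq (p s - kept p q s)%R 0%R.
  by rewrite (residual_eq0 lp lq cr Gs Gt e) mul0e.
by rewrite esum_share// mule1.
Qed.

Lemma esum_extend_row s : genealogy s0 n.+1 s ->
  \esum_(t in genealogy s0 n.+1) (extend p q r s t)%:E = (p s)%:E.
Proof.
move=> /genealogySP[{}s [a [-> Gs]]].
rewrite esum_genealogyS; last first.
  by move=> t Gt; rewrite lee_fin extend_ge0//; exact: genealogy_rcons.
under eq_esum => t Gt do
  rewrite (esum_extend a Gs Gt) EFinD [X in _ + X]EFinM.
rewrite esumD; first last.
- move=> t Gt; rewrite -EFinM lee_fin.
  by rewrite mulr_ge0 ?share_ge0// (residual_ge0 lp lq cr).
- by move=> t _; rewrite lee_fin mulr_ge0// overlap_ge0.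
rewrite esum_indic ?overlap_ge0// ge0_esumZl ?share_ge0//; last first.
  by move=> t Gt; rewrite lee_fin (residual_ge0 lp lq cr).
by rewrite (esum_residual lp lq cr Gs) -EFinM shareK// -EFinD addrC subrK.
Qed.

(** The product of the two shares is zero on the diagonal because the overlap
    at s equals p s or q s. *)
Lemma extend_diag s : extend p q r s s = overlap p q s.
Proof.
rewrite /extend eqxx mul1r /share (overlapC q p) /overlap.
by case: (leP (p s) (q s)) => _; rewrite subrr !(mul0r, mulr0) addr0.
Qed.

End extend_couples.

Lemma couples_extend (s0 : E) n p q r : path_law p -> path_law q ->
  couples s0 n p q r -> couples s0 n.+1 p q (extend p q r).
Proof.
move=> lp lq cr s t Gs Gt; split.
- exact: extend_ge0 lp lq cr _ _ Gs Gt.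
- exact: esum_extend_row lp lq cr _ Gs.
- under eq_esum => s' _ do rewrite -extendC.
  exact: esum_extend_row lq lp (couplesC cr) _ Gt.
- exact: extend_diag.
Qed.

(** * The coupling *)

Fixpoint mexit p q (n : nat) : seq E -> seq E -> R :=
  if n is n'.+1 then extend p q (mexit p q n')
  else fun s t => ((s == t)%:R * overlap p q s)%R.

Lemma couples_mexit (s0 : E) p q n : path_law p -> path_law q ->
    p [:: s0] = 1%R -> q [:: s0] = 1%R ->
  couples s0 n p q (mexit p q n).
Proof.
move=> lp lq p1 q1; elim: n => [|n IHn] /=; last exact: couples_extend.
have G0 s : genealogy s0 0 s -> s = [:: s0].
  by case: s => [|a [|b s]] [//= _ [->]].
have E0 (f : seq E -> \bar R) : 0 <= f [:: s0] ->
    \esum_(s in genealogy s0 0) f s = f [:: s0].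
  by move=> f0; apply: esum_single => // s /G0 ->; rewrite eqxx.
have ov : overlap p q [:: s0] = 1%R by rewrite /overlap p1 q1 minxx.
move=> s t /G0 -> /G0 ->.
by split; rewrite ?E0 ?eqxx ?ov ?mul1r ?p1 ?q1 ?lee_fin.
Qed.

End extension.

(** * Genealogical probabilities are path laws *)

Section genealogical_probabilities.
Context (dE : measure_display) (E : measurableType dE) (R : realType)
  (d : measure_display) (T : measurableType d) (P : probability T R)
  (X : nat -> {RV P >-> E}).
Hypothesis measurable_singleton : forall a : E, measurable [set a].

Lemma measurable_path s :
  measurable [set w | mkseq (fun i => X i w) (size s) = s].
Proof.
elim/last_ind: s => [|s a IHs].
  by rewrite (_ : [set _ | _] = setT)//; apply/seteqP.
rewrite (_ : [set _ | _] = [set w | mkseq (fun i => X i w) (size s) = s] `&`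
    X (size s) @^-1` [set a]); last first.
  apply/seteqP; split=> w /=; rewrite size_rcons mkseqS.
    by move/rcons_inj => [].
  by move=> [-> ->].
apply: measurableI => //; rewrite -[X in measurable X]setTI.
exact: measurable_funPT.
Qed.

Lemma genealogical_probability_fin_num s :
  genealogical_probability X s \is a fin_num.
Proof. by apply: fin_num_measure; exact: measurable_path. Qed.

Lemma genealogical_probability_children s : countable [set: E] ->
  \esum_(a in [set: E]) genealogical_probability X (rcons s a) =
  genealogical_probability X s.
Proof.
move=> cE; rewrite /genealogical_probability -measure_countable_bigcup//.
- congr (P _); apply/seteqP; split=> w /=.
    by move=> [a _ /=]; rewrite size_rcons mkseqS => /rcons_inj[].
  by move=> ws; exists (X (size s) w) => //=; rewrite size_rcons mkseqS ws.
- by move=> a _; exact: measurable_path.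
- move=> a b _ _ [w [/=]]; rewrite !size_rcons !mkseqS.
  by move=> /rcons_inj[_ <-] /rcons_inj[_ <-].
Qed.

Lemma genealogical_probability_start (s0 : E) :
  {ae P, forall w, X 0%N w = s0} -> genealogical_probability X [:: s0] = 1.
Proof.
move=> X0; have mX0 := measurable_path [:: s0].
rewrite /genealogical_probability -[X in P X]setCK probability_setC; last first.
  exact: measurableC.
suff /negligibleP -> :
    P.-negligible (~` [set w | mkseq (fun i => X i w) 1 = [:: s0]]).
- by rewrite sube0.
- exact: measurableC.
by apply: negligibleS X0 => w /= Xs0 X0; apply: Xs0; rewrite /mkseq/= X0.
Qed.

Lemma path_law_genealogical : countable [set: E] ->
  path_law (fine \o genealogical_probability X).
Proof.
move=> cE; split=> s /=; first by rewrite fine_ge0// measure_ge0.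
under eq_esum => a _ do rewrite fineK ?genealogical_probability_fin_num//.
rewrite genealogical_probability_children// fineK//.
exact: genealogical_probability_fin_num.
Qed.

End genealogical_probabilities.

Theorem theorem6 (R : realType) (dE : measure_display) (E : measurableType dE)
    (countableE : countable [set: E])
    (measurable_singleton : forall a : E, measurable [set a])
    (s0 : E)
    (d1 : measure_display) (T1 : measurableType d1) (P : probability T1 R)
    (X : nat -> {RV P >-> E})
    (d2 : measure_display) (T2 : measurableType d2) (Q : probability T2 R)
    (Y : nat -> {RV Q >-> E})
    (X0 : {ae P, forall w, X 0%N w = s0})
    (Y0 : {ae Q, forall w, Y 0%N w = s0}) :
  exists r : seq E -> seq E -> R,
    is_MEXIT_coupling s0 (genealogical_probability X)
      (genealogical_probability Y) r.
Proof.
pose p := fine \o genealogical_probability X.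
pose q := fine \o genealogical_probability Y.
have pE s : (p s)%:E = genealogical_probability X s.
  by rewrite fineK// genealogical_probability_fin_num.
have qE s : (q s)%:E = genealogical_probability Y s.
  by rewrite fineK// genealogical_probability_fin_num.
have lp : path_law p by exact: path_law_genealogical.
have lq : path_law q by exact: path_law_genealogical.
have cr n : couples s0 n p q (mexit p q n).
  by apply: couples_mexit => //; apply: EFin_inj;
    rewrite ?pE ?qE genealogical_probability_start.
(* A genealogy at time n has n+1 entries, so its time is (size s).-1. *)
exists (fun s t => mexit p q (size s).-1 s t); split; last first.
  move=> n s Gs; have [_ _ _] := cr n s s Gs Gs; rewrite Gs.1 /= => ->.
  by rewrite -pE -qE -EFin_min.
move=> n s t Gs Gt; have [r0 rp rq _] := cr n s t Gs Gt; split.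
- by rewrite Gs.1.
- by rewrite -pE -rp; apply: eq_esum => t' _; rewrite Gs.1.
- by rewrite -qE -rq; apply: eq_esum => s' [-> _].
- under eq_esum => a _ do under eq_esum => b _ do rewrite size_rcons Gs.1.
  by rewrite Gs.1 (extend_inherits lp lq (cr n)).
Qed.
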